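(* Let $n\ge 2$. The $n\times n$ matrix $$G_{n} = \begin{pmatrix} 2 & 4 & 8 & 16 & 32 & \cdots & 2^{n} \\ 2 & 2 & 4 & 8 & 16 & \cdots & 2^{n-1} \\ 0 & 2 & 2 & 4 & 8 & \cdots & 2^{n-2} \\ 0 & 0 & 2 & 2 & 4 & \cdots & 2^{n-3} \\ 0 & 0 & 0 & 2 & 2 & \cdots & 2^{n-4} \\ \vdots & \vdots & \vdots & \vdots & \vdots & \ddots & \vdots \\ 0 & 0 & 0 & 0 & 0 & \cdots & 2 \end{pmatrix}$$ (whose $(p,q)$ entry is $2^{q-p+1}$ if $q\ge p$, $2$ if $q=p-1$, and $0$ if $q<p-1$) is a production matrix for plane geometric graphs of point sets in convex position; that is, $v^{i+1}=G_n v^i$ for all $i$ with $2\le i\le n$.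
   Context: A geometric graph on a finite point set $\mathcal S\subseteq\mathbb R^2$ has vertex set $\mathcal S$ and edges that are straight-line segments with endpoints in $\mathcal S$; it is plane if no two edges intersect except at common endpoints. Graphs with $i$ vertices are considered on points $p_1,\dots,p_i$ in convex position labelled in counter-clockwise order. Two vertices are visible (from each other) if the line segment connecting them does not intersect the interior of any edge of the graph. The visibility degree of the root vertex $p_i$ of a graph on $\{p_1,\dots,p_i\}$ is the number of vertices visible from an additional vertex $p_{i+1}$ inserted between $p_i$ and $p_1$ in convex position, minus $2$. For $2\le i\le n+1$, $v^i$ is the $n$-dimensional column vector whose $j$-th entry is the number of plane geometric graphs on $i$ points in convex position whose root vertex has visibility degree $j-1$ (so $v^2=(2,0,\dots,0)^\top$). A production matrix is a matrix satisfying $v^{i+1}=G_nv^i$. *)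

(* Defs.v *)
From HB Require Import structures.
From mathcomp Require Import all_boot all_order all_algebra.
From mathcomp Require Import boolp classical_sets set_interval reals convex.
Set Implicit Arguments.
Unset Strict Implicit.
Unset Printing Implicit Defensive.
Import Order.TTheory GRing.Theory Num.Theory.
Local Open Scope ring_scope.

Notation plane_point R := 'rV[R]_2.

Definition segment (R : realType) (a b : plane_point R) : set (plane_point R) :=
  [set (1 - t) *: a + t *: b | t in `[0%R, 1%R]]%classic.

Definition open_segment (R : realType) (a b : plane_point R) :
    set (plane_point R) :=
  [set (1 - t) *: a + t *: b | t in `]0%R, 1%R[]%classic.

Definition ccw (R : realType) (a b c : plane_point R) : Prop :=
  0 < (b 0 0 - a 0 0) * (c 0 1 - a 0 1) - (b 0 1 - a 0 1) * (c 0 0 - a 0 0).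

Definition convex_hull (R : realType) (A : set (plane_point R)) :
    set (plane_point R) :=
  smallest (fun C : set (convex_lmodType (plane_point R)) => convex_set C) A.

Definition convex_position (R : realType) (m : nat)
    (p : 'I_m -> plane_point R) : Prop :=
  forall k : 'I_m, ~ convex_hull (p @` [set j | j <> k])%classic (p k).

(* For points in convex position, the orientation condition says that
   p_1, ..., p_m is their counter-clockwise cyclic order. *)
Definition ccw_convex_position (R : realType) (m : nat)
    (p : 'I_m -> plane_point R) : Prop :=
  convex_position p /\
  forall a b c : 'I_m, (a < b < c)%N -> ccw (p a) (p b) (p c).

(* The sequence p_1, ..., p_m, q. *)
Definition extend (R : realType) (m : nat) (p : 'I_m -> plane_point R)
    (q : plane_point R) : 'I_m.+1 -> plane_point R :=
  fun k => oapp p q (unlift ord_max k).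

(* A geometric graph on p_1, ..., p_m is given by its set of edges: the vertex
   p_(a+1) is represented by its index a : 'I_m, and the edge joining p_(a+1)
   and p_(b+1) by the pair (a, b) with a < b, so that every undirected edge has
   exactly one representative. *)
Definition is_graph (m : nat) (E : {set 'I_m * 'I_m}) : Prop :=
  forall e, e \in E -> (e.1 < e.2)%N.

Definition endpoint (m : nat) (e : 'I_m * 'I_m) (v : 'I_m) : Prop :=
  v = e.1 \/ v = e.2.

Definition plane (R : realType) (m : nat) (p : 'I_m -> plane_point R)
    (E : {set 'I_m * 'I_m}) : Prop :=
  forall e f, e \in E -> f \in E -> e <> f ->
  forall z, segment (p e.1) (p e.2) z -> segment (p f.1) (p f.2) z ->
  exists v, [/\ endpoint e v, endpoint f v & z = p v].

Definition visible (R : realType) (m : nat) (p : 'I_m -> plane_point R)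
    (E : {set 'I_m * 'I_m}) (x y : plane_point R) : Prop :=
  forall e, e \in E ->
  forall z, segment x y z -> ~ open_segment (p e.1) (p e.2) z.

(* Visibility degree of the root p_m of E, where q is the additional vertex
   inserted between p_m and p_1. *)
Definition visibility_degree (R : realType) (m : nat)
    (p : 'I_m -> plane_point R) (q : plane_point R)
    (E : {set 'I_m * 'I_m}) : int :=
  #|[set k : 'I_m | `[< visible p E q (p k) >] ]%SET|%:Z - 2.

(* The vector v^m in dimension n, computed from the points p_1, ..., p_m and
   the additional vertex q; row j : 'I_n is the (j+1)-st entry, hence counts
   the graphs with visibility degree j. *)
Definition degree_vector (R : realType) (n m : nat)
    (p : 'I_m -> plane_point R) (q : plane_point R) : 'cV[int]_n :=
  \col_(j < n) #|[set E : {set 'I_m * 'I_m} |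
    `[< [/\ is_graph E, plane p E & visibility_degree p q E = j%:Z] >] ]%SET|%:Z.

Definition Gmx (n : nat) : 'M[int]_n :=
  \matrix_(r < n, c < n)
    if (r <= c)%N then 2 ^+ (c - r + 1)
    else if (r == c.+1 :> nat) then 2 else 0.

(* Main.v *)
(** Only the orientations of triples matter.  Two chords of points in convex
    position meet outside a common endpoint exactly when their endpoints
    alternate, and the additional vertex sees p_k exactly when no edge p_a p_b
    has a < k < b.  A plane graph on i + 1 points is therefore a plane graph E
    on the first i points together with a set S of vertices visible in E, the
    neighbours of the new root.  In the new graph the visible vertices are the
    new root and the visible vertices of E not beyond the first element of S;
    counting the sets S by the position of their first element among the
    visible vertices of E gives the entries of G_n. *)
Require Import Defs.
From mathcomp Require Import all_boot all_order all_algebra.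
From mathcomp Require Import boolp classical_sets reals.
From mathcomp Require Import ring lra zify.
From mathcomp Require Import fintype finset.
Set Implicit Arguments.
Unset Strict Implicit.
Unset Printing Implicit Defensive.
Import Order.TTheory GRing.Theory Num.Theory.
Local Open Scope ring_scope.

(** * Orientation of triples and points on segments *)

Section Orientation.
Variable R : realType.
Implicit Types a b c d z : plane_point R.

(** Twice the signed area of the triangle; [ccw] is its positivity by conversion. *)
Definition orient a b c : R :=
  (b 0 0 - a 0 0) * (c 0 1 - a 0 1) - (b 0 1 - a 0 1) * (c 0 0 - a 0 0).

Lemma plane_pointP a b : a 0 0 = b 0 0 -> a 0 1 = b 0 1 -> a = b.
Proof.
move=> h0 h1; apply/rowP => j; case: j => -[|[|//]] hj.
- by rewrite (_ : Ordinal hj = 0) //; apply/val_inj.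
- by rewrite (_ : Ordinal hj = 1) //; apply/val_inj.
Qed.

Lemma orient_rot a b c : orient b c a = orient a b c.
Proof. by rewrite /orient; ring. Qed.

Lemma orient_swap a b c : orient a c b = - orient a b c.
Proof. by rewrite /orient; ring. Qed.

Lemma orient_left a b : orient a b a = 0.
Proof. by rewrite /orient; ring. Qed.

Lemma orient_right a b : orient a b b = 0.
Proof. by rewrite /orient; ring. Qed.

Lemma orient_affine a b c d (t : R) :
  orient a b ((1 - t) *: c + t *: d) =
  (1 - t) * orient a b c + t * orient a b d.
Proof. by rewrite /orient !mxE; ring. Qed.

Lemma orient_segment a b z : segment a b z -> orient a b z = 0.
Proof.
by case=> t _ <-; rewrite orient_affine orient_left orient_right; ring.
Qed.

Lemma open_segmentW a b z : open_segment a b z -> segment a b z.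
Proof.
case=> t; rewrite /= in_itv /= => /andP[t0 t1] <-; exists t => //=.
by rewrite in_itv /= !ltW.
Qed.

Lemma open_segment_sym a b z : open_segment a b z -> open_segment b a z.
Proof.
case=> t; rewrite /= in_itv /= => /andP[t0 t1] <-; exists (1 - t).
  by rewrite /= in_itv /=; apply/andP; split; lra.
by apply: plane_pointP; rewrite !mxE; ring.
Qed.

Lemma open_segment_left a b : open_segment a b a -> a = b.
Proof.
case=> t; rewrite /= in_itv /= => /andP[t0 t1] h.
have tN0 : t != 0 by rewrite gt_eqF.
have coord k : a 0 k = b 0 k.
  have := congr1 (fun x : plane_point R => x 0 k) h.
  rewrite !mxE => hk; apply: (mulfI tN0).
  by apply/eqP; rewrite -subr_eq0; apply/eqP; move: hk; lra.
exact: plane_pointP.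
Qed.

Lemma open_segment_right a b : open_segment a b b -> a = b.
Proof. by move/open_segment_sym/open_segment_left. Qed.

(* The affine dependency [bcd] a + [abd] c = [acd] b + [abc] d, in which both
   sides have the same total weight, exhibits the crossing point. *)
Lemma diagonals_meet a b c d :
  0 < orient b c d -> 0 < orient a c d -> 0 < orient a b d ->
  0 < orient a b c -> exists2 z, open_segment a c z & open_segment b d z.
Proof.
move=> A0 B0 C0 D0.
have AC : orient b c d + orient a b d = orient a c d + orient a b c.
  by rewrite /orient; ring.
have AC0 : 0 < orient b c d + orient a b d by rewrite addr_gt0.
have itv (x y : R) : 0 < x -> 0 < y -> 0 < y / (x + y) < 1.
  move=> x0 y0; have xy0 := addr_gt0 x0 y0.
  by rewrite divr_gt0 //= ltr_pdivrMr // mul1r ltrDr.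
exists ((1 - orient a b d / (orient b c d + orient a b d)) *: a
        + orient a b d / (orient b c d + orient a b d) *: c).
  by eexists; last reflexivity; rewrite /= in_itv /= itv.
exists (orient a b c / (orient b c d + orient a b d)).
  by rewrite /= in_itv /= AC itv.
by apply: plane_pointP; rewrite !mxE; move/lt0r_neq0: AC0;
  rewrite /orient => AC0; field.
Qed.

End Orientation.

(** * Plane graphs as noncrossing graphs *)

Section CcwPoints.
Variables (R : realType) (m : nat) (p : 'I_m -> plane_point R).
Hypothesis hp : forall a b c : 'I_m, (a < b < c)%N -> ccw (p a) (p b) (p c).
Implicit Types (a b c d : 'I_m) (e f : 'I_m * 'I_m) (E : {set 'I_m * 'I_m}).

Lemma orient_gt0 a b c : (a < b)%N -> (b < c)%N -> 0 < orient (p a) (p b) (p c).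
Proof. by move=> ab bc; apply: hp; rewrite ab bc. Qed.

Lemma orient_out_gt0 a b c : (a < b)%N -> (c < a)%N || (b < c)%N ->
  0 < orient (p a) (p b) (p c).
Proof.
by move=> ab /orP[ca|bc]; [rewrite orient_rot|]; apply: orient_gt0.
Qed.

Lemma orient_out a b c : (a < b)%N -> ~~ (a < c < b)%N ->
  0 <= orient (p a) (p b) (p c).
Proof.
move=> ab; rewrite negb_and -!leqNgt.
have [->|ca] := eqVneq c a; first by rewrite orient_left.
have [->|cb] := eqVneq c b; first by rewrite orient_right.
move=> h; apply/ltW/orient_out_gt0 => //.
by move: ca cb h; rewrite -!val_eqE /=; lia.
Qed.

Lemma orient_in a b c : (a <= c <= b)%N -> orient (p a) (p b) (p c) <= 0.
Proof.
move=> /andP[].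
rewrite leq_eqVlt => /predU1P[/val_inj ->|ac]; first by rewrite orient_left.
rewrite leq_eqVlt => /predU1P[/val_inj ->|cb]; first by rewrite orient_right.
by rewrite orient_swap oppr_le0 ltW // orient_gt0.
Qed.

Lemma orient_eq0 a b c : (a < b)%N -> orient (p a) (p b) (p c) = 0 ->
  c = a \/ c = b.
Proof.
move=> ab o0.
have [->|ca] := eqVneq c a; first by left.
have [->|cb] := eqVneq c b; first by right.
have [/andP[ac cb']|h] := boolP (a < c < b)%N.
  by have := orient_gt0 ac cb'; rewrite orient_swap o0 oppr0 ltxx.
have out : (c < a)%N || (b < c)%N by move: ca cb h; rewrite -!val_eqE /=; lia.
by have := orient_out_gt0 ab out; rewrite o0 ltxx.
Qed.

(** Here [e] is the edge that starts first; [ncgraph] ranges over ordered pairs, so it excludes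
    alternation in either order. *)
Definition crossing (e f : 'I_m * 'I_m) :=
  [&& e.1 < f.1, f.1 < e.2 & e.2 < f.2]%N.

Definition ncgraph (E : {set 'I_m * 'I_m}) :=
  [forall e in E, (e.1 < e.2)%N] &&
  [forall e in E, forall f in E, ~~ crossing e f].

Definition uncovered (E : {set 'I_m * 'I_m}) : {set 'I_m} :=
  [set k : 'I_m | [forall e in E, ~~ (e.1 < k < e.2)%N]].

(** The point [z] lies on the line of [e], so the orientations of the two ends of [f] relative to
    [e], weighted by their coefficients in [z], add up to zero. *)
Lemma noncrossing_meet e f z : (e.1 < e.2)%N -> (f.1 < f.2)%N -> e <> f ->
  ~~ crossing e f -> ~~ crossing f e ->
  segment (p e.1) (p e.2) z -> segment (p f.1) (p f.2) z ->
  exists v, [/\ endpoint e v, endpoint f v & z = p v].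
Proof.
case: e f => [a b] [c d]; rewrite /crossing /endpoint /= => ab cd ef xef xfe.
move=> /orient_segment ze [t /=]; rewrite in_itv /= => /andP[t0 t1] zE.
set oc := orient (p a) (p b) (p c); set od := orient (p a) (p b) (p d).
have t1' : 0 <= 1 - t by rewrite subr_ge0.
have sum0 : (1 - t) * oc + t * od = 0 by rewrite -orient_affine zE.
(* Both endpoints of f lie weakly on the same side of e, so neither summand can
   be compensated by the other. *)
have [c0 d0] : (1 - t) * oc = 0 /\ t * od = 0.
  have [/andP[cin din]|out] := boolP ((a <= c <= b) && (a <= d <= b))%N.
    have h1 : (1 - t) * oc <= 0 by rewrite mulr_ge0_le0 ?orient_in.
    have h2 : t * od <= 0 by rewrite mulr_ge0_le0 ?orient_in.
    by clear -sum0 h1 h2; split; lra.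
  have [cout dout] : ~~ (a < c < b)%N /\ ~~ (a < d < b)%N.
    by split; move: xef xfe out ab cd; lia.
  have h1 : 0 <= (1 - t) * oc by rewrite mulr_ge0 ?orient_out.
  have h2 : 0 <= t * od by rewrite mulr_ge0 ?orient_out.
  by clear -sum0 h1 h2; split; lra.
(* For [t] equal to 0 or 1 the point is an end of [f]; otherwise both ends of [f] are ends of [e],
   forcing [e = f]. *)
have [tE|tN0] := eqVneq t 0.
  exists c; split; last by rewrite -zE tE subr0 scale1r scale0r addr0.
  - by apply: orient_eq0 => //; move: c0; rewrite tE subr0 mul1r.
  - by left.
have [tE|tN1] := eqVneq t 1.
  exists d; split; last by rewrite -zE tE subrr scale0r scale1r add0r.
  - by apply: orient_eq0 => //; move: d0; rewrite tE mul1r.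
  - by right.
case: ef; move/eqP: c0; rewrite mulf_eq0 subr_eq0 eq_sym (negbTE tN1) /=.
move/eqP: d0; rewrite mulf_eq0 (negbTE tN0) /= => /eqP/(orient_eq0 ab) dab.
move=> /eqP/(orient_eq0 ab) cab.
by move: cd ab; case: dab => ->; case: cab => ->; rewrite ?ltnn // => h1 h2;
  have := ltn_trans h1 h2; rewrite ltnn.
Qed.

Lemma crossing_meet e f : crossing e f ->
  exists2 z, open_segment (p e.1) (p e.2) z & open_segment (p f.1) (p f.2) z.
Proof.
case: e f => [a b] [c d] /and3P[/= ac cb bd].
by apply: diagonals_meet; apply: orient_gt0; lia.
Qed.

Lemma planeP E : (is_graph E /\ plane p E) <-> ncgraph E.
Proof.
split=> [[grE plE]|/andP[/forall_inP grE /forall_inP ncE]].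
  apply/andP; split; first by apply/forall_inP => e /grE.
  apply/forall_inP => e eE; apply/forall_inP => f fE; apply/negP => xef.
  have [z /open_segmentW ze /open_segmentW zf] := crossing_meet xef.
  have ef : e <> f by move=> ef; move: xef; rewrite ef /crossing ltnn.
  have [v [ev fv _]] := plE e f eE fE ef z ze zf.
  (* Alternation makes the four ends distinct, so [v] cannot be shared. *)
  case/and3P: xef => h1 h2 h3.
  by case: ev fv => -> [] /(congr1 val) /= h; move: h1 h2 h3 => /=; lia.
split=> [e eE|e f eE fE ef z]; first exact: grE.
apply: noncrossing_meet => //; try exact: grE.
- exact: (forall_inP (ncE e eE)).
- exact: (forall_inP (ncE f fE)).
Qed.

End CcwPoints.

(** * Visibility from the additional vertex *)

Lemma extend_lift (R : realType) m (p : 'I_m -> plane_point R) q k :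
  extend p q (lift ord_max k) = p k.
Proof. by rewrite /extend liftK. Qed.

Lemma extend_max (R : realType) m (p : 'I_m -> plane_point R) q :
  extend p q ord_max = q.
Proof. by rewrite /extend unlift_none. Qed.

Section Visibility.
Variables (R : realType) (m : nat) (p : 'I_m -> plane_point R).
Variable q : plane_point R.
Hypothesis hpq : ccw_convex_position (extend p q).

Lemma ccw_initial (a b c : 'I_m) : (a < b < c)%N -> ccw (p a) (p b) (p c).
Proof.
move=> abc; have := hpq.2 (lift ord_max a) (lift ord_max b) (lift ord_max c).
by rewrite !extend_lift !lift_max; apply.
Qed.

Lemma ccw_last (a b : 'I_m) : (a < b)%N -> 0 < orient (p a) (p b) q.
Proof.
move=> ab; have := hpq.2 (lift ord_max a) (lift ord_max b) ord_max.
by rewrite !extend_lift extend_max !lift_max /= ab ltn_ord; apply.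
Qed.

(** An edge covering [k] and the segment from [p k] to [q] are diagonals of a convex quadrilateral.
    If [e] does not cover [k], then [q] is strictly and [p k] weakly to the left of [e]; the segment
    can reach the line of [e] only at [p k], which is then an end of [e] and not in its interior. *)
Lemma visibleP E k : is_graph E -> visible p E q (p k) <-> k \in uncovered E.
Proof.
move=> grE; rewrite inE; split=> [vis|/forall_inP unc e eE z zqk zab].
  apply/forall_inP => e eE; apply/negP => /andP[ak kb].
  have [z zab zkq] : exists2 z, open_segment (p e.1) (p e.2) z &
                               open_segment (p k) q z.
    apply: diagonals_meet; try exact: ccw_last.
      exact/ccw_last/grE.
    by apply: (orient_gt0 ccw_initial).
  exact: (vis e eE z (open_segmentW (open_segment_sym zkq)) zab).
have ab := grE e eE; have oq := ccw_last ab.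
have ok := orient_out ccw_initial ab (unc e eE).
have zo := orient_segment (open_segmentW zab).
case: zqk => t /=; rewrite in_itv /= => /andP[t0 t1] zE.
move: zo; rewrite -zE orient_affine => zo.
have h1 : 0 <= (1 - t) * orient (p e.1) (p e.2) q.
  by apply: mulr_ge0; [rewrite subr_ge0 | exact: ltW].
have h2 := mulr_ge0 t0 ok.
have /eqP : (1 - t) * orient (p e.1) (p e.2) q = 0 by lra.
rewrite mulf_eq0 (gt_eqF oq) orbF subr_eq0 => /eqP tE.
move: zE zo; rewrite -tE subrr !(scale0r, scale1r, mul0r, mul1r) !add0r.
move=> zE /(orient_eq0 ccw_initial ab) kab.
have pab : p e.1 = p e.2.
  move: zab; rewrite -zE; case: kab => ->; first exact: open_segment_left.
  exact: open_segment_right.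
by move: oq; rewrite pab /orient !subrr !mul0r subrr ltxx.
Qed.

(** The right-hand side does not mention the points, so the configurations for [i] and [i + 1]
    vertices may be unrelated. The shift [j.+2] undoes the subtraction in [visibility_degree]. *)
Lemma degree_vectorE n :
  degree_vector n p q =
  \col_(j < n) #|[set E | @ncgraph m E & #|uncovered E| == j.+2]|%:Z.
Proof.
apply/colP => j; rewrite !mxE; congr (Posz _); apply: eq_card => E.
have degE : is_graph E ->
    visibility_degree p q E = j%:Z <-> #|uncovered E| = j.+2.
  move=> grE; rewrite /visibility_degree.
  suff -> : [set k | `[< visible p E q (p k) >]]%SET = uncovered E.
    by move: #|uncovered E| (nat_of_ord j) => x y; split; lia.
  by apply/setP => k; rewrite inE; apply/asboolP/idP => /(visibleP k grE).
rewrite !inE; apply/asboolP/andP => [[grE plE /(degE grE)/eqP deg]|[ncE deg]].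
  by split=> //; apply/(planeP ccw_initial).
have [grE plE] := (planeP ccw_initial E).2 ncE.
by split=> //; apply/(degE grE)/eqP.
Qed.

End Visibility.

(** * Attaching a new root *)

Section Glue.
Variable m : nat.
Implicit Types (E : {set 'I_m * 'I_m}) (S : {set 'I_m}).
Implicit Types (F : {set 'I_m.+1 * 'I_m.+1}).

(** The new root is [ord_max], and [lift ord_max] keeps the old indices. Edges list the smaller
    index first, so none starts at the root. *)
Definition glue (ES : {set 'I_m * 'I_m} * {set 'I_m}) :
    {set 'I_m.+1 * 'I_m.+1} :=
  [set e | match unlift ord_max e.1, unlift ord_max e.2 with
           | Some a, Some b => (a, b) \in ES.1
           | Some a, None => a \in ES.2
           | None, _ => false
           end].

Definition unglue F : {set 'I_m * 'I_m} * {set 'I_m} :=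
  ([set e | (lift ord_max e.1, lift ord_max e.2) \in F],
   [set a | (lift ord_max a, ord_max) \in F]).

Lemma in_glue_lift E S a b :
  ((lift ord_max a, lift ord_max b) \in glue (E, S)) = ((a, b) \in E).
Proof. by rewrite inE /= !liftK. Qed.

Lemma in_glue_max E S a : ((lift ord_max a, ord_max) \in glue (E, S)) =
  (a \in S).
Proof. by rewrite inE /= liftK unlift_none. Qed.

Lemma in_glue_root E S b : ((ord_max, b) \in glue (E, S)) = false.
Proof. by rewrite inE /= unlift_none. Qed.

Lemma glueK : cancel glue unglue.
Proof.
move=> [E S]; congr pair; apply/setP => x.
  by rewrite inE in_glue_lift; case: x.
by rewrite inE in_glue_max.
Qed.

Lemma unglueK F : ncgraph F -> glue (unglue F) = F.
Proof.
move=> /andP[/forall_inP grF _]; apply/setP => -[x y].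
case: (unliftP ord_max x) => [a ->|->]; last first.
  rewrite in_glue_root; apply/esym/negP => /grF /=.
  by rewrite ltnNge -ltnS ltn_ord.
case: (unliftP ord_max y) => [b ->|->]; first by rewrite in_glue_lift inE.
by rewrite in_glue_max inE.
Qed.

Lemma glue_forall E S (P : pred ('I_m.+1 * 'I_m.+1)) :
  [forall e in glue (E, S), P e] =
  [forall e in E, P (lift ord_max e.1, lift ord_max e.2)] &&
  [forall a in S, P (lift ord_max a, ord_max)].
Proof.
apply/forall_inP/andP => [h|[/forall_inP hE /forall_inP hS] [x y]].
  split; apply/forall_inP; last by move=> a aS; apply: h; rewrite in_glue_max.
  by move=> e eE; apply: h; rewrite in_glue_lift -surjective_pairing.
case: (unliftP ord_max x) => [a ->|->]; last by rewrite in_glue_root.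
case: (unliftP ord_max y) => [b ->|->]; first by rewrite in_glue_lift => /hE.
by rewrite in_glue_max => /hS.
Qed.

Lemma bump_ord (a : 'I_m) : bump m a = a.
Proof. exact: lift_max. Qed.

(** An old edge crosses the root edge at [s] exactly when it covers [s]. *)
Lemma ncgraph_glue E S :
  ncgraph (glue (E, S)) = ncgraph E && (S \subset uncovered E).
Proof.
rewrite /ncgraph !glue_forall -!andbA.
have -> : [forall a in S, (lift (@ord_max m) a < @ord_max m)%N].
  by apply/forall_inP => a _; rewrite /= bump_ord ltn_ord.
have -> : [forall e in E, (lift (@ord_max m) e.1 < lift (@ord_max m) e.2)%N] =
          [forall e in E, (e.1 < e.2)%N].
  by apply: eq_forallb_in => e _; rewrite /= !bump_ord.
congr (_ && _) => /=; apply/andP/andP.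
  case=> /forall_inP hE _; split.
    apply/forall_inP => e /hE; rewrite glue_forall => /andP[/forall_inP he _].
    by apply/forall_inP => f /he; rewrite /crossing /= !bump_ord.
  apply/subsetP => s sS; rewrite inE; apply/forall_inP => e /hE.
  rewrite glue_forall => /andP[_ /forall_inP /(_ s sS)].
  by rewrite /crossing /= !bump_ord ltn_ord andbT.
case=> /forall_inP hE /subsetP SU; split; apply/forall_inP.
  move=> e eE; rewrite glue_forall; apply/andP; split; apply/forall_inP.
    move=> f fE; rewrite /crossing /= !bump_ord.
    exact: (forall_inP (hE e eE)).
  move=> s /SU; rewrite inE => /forall_inP /(_ e eE).
  by rewrite /crossing /= !bump_ord ltn_ord andbT.
(* A root edge is never the first edge of a crossing, since it ends at the largest index. *)
move=> s sS; apply/forall_inP => f _.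
have fm : (f.2 <= m)%N by rewrite -ltnS.
by rewrite /crossing /= (ltnNge m) fm !andbF.
Qed.

(** The part of [U] up to the first element of [S]; all of [U] when [S] is empty. *)
Definition lower S (U : {set 'I_m}) : {set 'I_m} :=
  [set u in U | [forall s in S, (u <= s)%N]].

(** The root edge at [s] hides exactly the old vertices after [s]; the successor counts the root
    itself. *)
Lemma card_uncovered_glue E S :
  #|uncovered (glue (E, S))| = #|lower S (uncovered E)|.+1.
Proof.
have -> : uncovered (glue (E, S)) =
    ord_max |: [set lift ord_max u | u in lower S (uncovered E)].
  apply/setP => k; rewrite !inE.
  case: (unliftP ord_max k) => [u ->|->]; last first.
    rewrite eqxx; apply/forall_inP => e _.
    by rewrite negb_and -!leqNgt -[(e.2 <= _)%N]ltnS ltn_ord orbT.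
  rewrite eq_sym (negbTE (neq_lift ord_max u)) /= mem_imset ?inE;
    last exact: lift_inj.
  rewrite glue_forall; congr (_ && _); apply: eq_forallb_in => e _ /=.
    by rewrite /= !bump_ord.
  by rewrite /= !bump_ord ltn_ord andbT -leqNgt.
rewrite cardsU1 card_imset; last exact: lift_inj.
suff -> :
  ord_max \notin [set lift ord_max u | u in lower S (uncovered E)] by [].
by apply/imsetP => -[u _ /eqP]; rewrite (negbTE (neq_lift _ _)).
Qed.

End Glue.

(** * Counting neighbour sets by their first element *)

Lemma ex_min_ord m (U : {set 'I_m}) :
  U != set0 -> exists2 x, x \in U & {in U, forall u : 'I_m, x <= u}%N.
Proof.
case/set0Pn => x0 x0U; case: (arg_minnP (fun u : 'I_m => u : nat) x0U).
by move=> x xU xmin; exists x.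
Qed.

Lemma lower_eq0 m (U S : {set 'I_m}) :
  S \subset U -> (#|lower S U| == 0%N) = (#|U| == 0%N).
Proof.
move=> /subsetP SU; rewrite !cards_eq0; apply/eqP/eqP => [low0|->]; last first.
  by apply/setP => u; rewrite !inE.
apply/eqP; apply: contraT => /ex_min_ord[x xU xmin].
suff : x \in lower S U by rewrite low0 inE.
by rewrite inE xU; apply/forall_inP => s /SU; apply: xmin.
Qed.

(** If [S] misses the least element [x], then [x] only adds one to the lower part; if [S] contains
    it, the lower part is the singleton of [x] and the rest of [S] is free. *)
Lemma sets_lower_rec m (U : {set 'I_m}) x k :
  x \in U -> {in U, forall u : 'I_m, x <= u}%N ->
  #|[set S : {set 'I_m} | S \subset U & #|lower S U| == k.+1]| =
  (#|[set S : {set 'I_m} | S \subset U :\ x & #|lower S (U :\ x)| == k]| +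
   (k == 0) * 2 ^ #|U :\ x|)%N.
Proof.
move=> xU xmin; rewrite -(cardsID [set S : {set 'I_m} | x \in S]) addnC.
congr addn.
  apply: eq_card => S; rewrite !inE subsetD1 andbA [_ && (S \subset U)]andbC.
  have [SU|//] := boolP (S \subset U).
  have [//|xS /=] := boolP (x \in S).
  have -> : lower S U = x |: lower S (U :\ x).
    apply/setP => u; rewrite !inE; have [->|//] := eqVneq u x.
    by rewrite xU; apply/forall_inP => s sS; apply/xmin/(subsetP SU).
  by rewrite cardsU1 !inE eqxx.
have low (S : {set 'I_m}) : S \subset U -> x \in S -> lower S U = [set x].
  move=> /subsetP SU xS; apply/setP => u; rewrite !inE.
  have [->|ux] := eqVneq u x.
    by rewrite xU; apply/forall_inP => s /SU; apply: xmin.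
  apply/negP => /andP[/xmin xu /forall_inP /(_ x xS)].
  by move: ux xu; rewrite -val_eqE /=; lia.
case: k => [|k]; last first.
  rewrite mul0n; apply/eqP; rewrite cards_eq0; apply/eqP/setP => S.
  rewrite !inE; apply/negP => /andP[/andP[SU +] xS].
  by rewrite low // cards1.
rewrite mul1n -card_powerset.
rewrite -(@card_in_imset _ _ (fun T => x |: T) (powerset (U :\ x))).
  apply: eq_card => S; rewrite !inE.
  apply/idP/imsetP => [/andP[/andP[SU _] xS]|[T]].
    by exists (S :\ x); rewrite ?setD1K // powersetE setSD.
  rewrite powersetE => TU ->; rewrite setU11 andbT.
  have xTU : x |: T \subset U.
    by rewrite subUset sub1set xU (subset_trans TU) ?subsetDl.
  by rewrite xTU low ?setU11 ?cards1.
move=> S T; rewrite !powersetE !subsetD1 => /andP[_ xS] /andP[_ xT] ST.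
by rewrite -(setU1K xS) ST setU1K.
Qed.

(** The first element of [S] is the element of [U] in position [k.+1], and all later elements are
    free. When that element is the last one, the empty set also qualifies, which gives 2 instead of
    1. *)
Lemma card_sets_lower m (U : {set 'I_m}) k :
  #|[set S : {set 'I_m} | S \subset U & #|lower S U| == k.+1]| =
  (if k.+1 < #|U| then 2 ^ (#|U| - k.+1) else (#|U| == k.+1) * 2)%N.
Proof.
elim: k U => [|k IHk] U.
all: have [->|/ex_min_ord[x xU xmin]] := eqVneq U set0;
  first by rewrite cards0 /=; apply/eqP; rewrite cards_eq0; apply/eqP/setP => S;
    rewrite !inE subset0; apply/negP => /andP[/eqP -> /eqP low];
    have /eqP := @lower_eq0 m set0 set0 (subxx _); rewrite low cards0.
all: rewrite (sets_lower_rec _ xU xmin) (cardsD1 x U) xU add1n.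
  (* An empty lower part is outside the range of the induction; it occurs only when nothing but [x]
     was in [U], and then for the empty [S] alone. *)
  have -> : [set S : {set 'I_m} | S \subset U :\ x
                                & #|lower S (U :\ x)| == 0%N] =
            if #|U :\ x| == 0%N then [set set0] else set0.
    apply/setP => S; rewrite inE; have [SU|SU] /= := boolP (S \subset U :\ x).
      rewrite lower_eq0 //; have [U0|] := eqVneq; last by rewrite inE.
      by move: SU; rewrite (cards0_eq U0) subset0 inE.
    have [U0|] := eqVneq; last by rewrite inE.
    by move: SU; rewrite (cards0_eq U0) subset0 inE => /negbTE.
  case: #|U :\ x| => [|d]; first by rewrite cards1.
  by rewrite cards0 add0n mul1n subSS subn0.
by rewrite mul0n addn0 IHk ltnS subSS eqSS.
Qed.

(** * The recurrence and the entries of the matrix *)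

Lemma card_uncovered_ge2 m (E : {set 'I_m * 'I_m}) :
  (2 <= m)%N -> (2 <= #|uncovered E|)%N.
Proof.
case: m E => [|[|m]] // E _.
have <- : #|[set (@ord0 m.+1); ord_max]| = 2%N by rewrite cards2.
apply/subset_leq_card/subsetP => k; rewrite !inE => /orP[] /eqP ->;
  apply/forall_inP => e _; rewrite ?ltn0 //.
by rewrite negb_and -!leqNgt -[(e.2 <= _)%N]ltnS ltn_ord orbT.
Qed.

Lemma card_ncgraph_glue m r :
  #|[set F | @ncgraph m.+1 F & #|uncovered F| == r.+2]| =
  (\sum_(E | @ncgraph m E)
     #|[set S : {set 'I_m} | S \subset uncovered E
                           & #|lower S (uncovered E)| == r.+1]|)%N.
Proof.
rewrite -sum1dep_card (reindex (@glue m)) /=; last first.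
  exists (@unglue m) => [ES _|F]; first exact: glueK.
  by rewrite inE => /andP[ncF _]; rewrite unglueK.
under [RHS]eq_bigr => E _ do rewrite -sum1dep_card.
rewrite pair_big_dep /=; apply: eq_bigl => -[E S] /=.
by rewrite ncgraph_glue card_uncovered_glue eqSS andbA.
Qed.

Theorem theorem8 (R : realType) (n : nat) (hn : (2 <= n)%N)
  (i : nat) (hi : (2 <= i <= n)%N)
  (p : 'I_i -> plane_point R) (q : plane_point R)
  (hpq : ccw_convex_position (extend p q))
  (p' : 'I_i.+1 -> plane_point R) (q' : plane_point R)
  (hpq' : ccw_convex_position (extend p' q')) :
  degree_vector n p' q' = Gmx n *m degree_vector n p q.
Proof.
case/andP: hi => i2 ile; rewrite !degree_vectorE //; apply/colP => r.
rewrite !mxE card_ncgraph_glue -natz natr_sum.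
(* Expanding each entry of the vector as a sum over graphs lets both sides be compared graph by
   graph: [E] contributes only to the column [c] given by its own degree. *)
transitivity (\sum_(c < n) \sum_(E | @ncgraph i E)
    Gmx n r c * (#|uncovered E| == c.+2)%:R); last first.
  apply: eq_bigr => c _; rewrite -mulr_sumr; congr (_ * _); rewrite mxE.
  rewrite -sum1dep_card -natz natr_sum [RHS]big_mkcondr /=.
  by apply: eq_bigr => E _; case: eqP.
rewrite exchange_big /=; apply: eq_bigr => E _.
(* These bounds, with [i <= n], make [#|uncovered E| - 2] an untruncated and valid column index. *)
have U2 := card_uncovered_ge2 E i2.
have Ui : (#|uncovered E| <= i)%N by rewrite -[leqRHS]card_ord max_card.
have cn : (#|uncovered E| - 2 < n)%N by lia.
rewrite (bigD1 (Ordinal cn)) //= big1 => [|c]; last first.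
  rewrite -val_eqE /= => cU; case: eqP => [UE|]; last by rewrite mulr0.
  by move: cU; rewrite UE subn2 eqxx.
rewrite addr0 card_sets_lower mxE /=.
move: #|uncovered E| U2 (nat_of_ord r) => d d2 k.
have -> : d == (d - 2).+2 by lia.
(* With column [c = d - 2], the exponent [c - k + 1] is [d - k.+1], and the subdiagonal [k = c.+1]
   is the case [d = k.+1]. *)
rewrite mulr1; have [kd|dk] := leqP k (d - 2).
  by rewrite ifT; [rewrite natrX; congr (_ ^+ _); lia | lia].
rewrite ifF; last by lia.
have [->|dk1] := eqVneq d k.+1; first by rewrite ifT //; lia.
by rewrite ifF //; lia.
Qed.
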